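(* For $n\geq 1$, the number of permutations $\pi\in\mathcal{S}_n$ such that both $\pi$ and $\theta(\pi)$ avoid $231$ equals $2^{n-1}$.
   Context: $\mathcal{S}_n$ is the symmetric group on $[n]$, permutations in one-line notation $\pi_1\cdots\pi_n$. A permutation avoids a pattern $\tau$ if it has no subsequence order-isomorphic to $\tau$. The standard cycle notation of $\pi$ writes each cycle (fixed points included) with its largest element first and orders cycles by increasing largest element. The fundamental bijection $\theta:\mathcal{S}_n\to\mathcal{S}_n$ maps $\pi$ to the permutation whose one-line notation is obtained by erasing the parentheses of the standard cycle notation of $\pi$. *)

(* Defs.v *)
From mathcomp Require Import all_boot all_fingroup.
Set Implicit Arguments.
Unset Strict Implicit.
Unset Printing Implicit Defensive.

(* Ordinals are 0-based, so values are shifted to lie in [n] = {1, ..., n}. *)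
Definition one_line (n : nat) (s : 'S_n) : seq nat :=
  [seq (val (s i)).+1 | i <- enum 'I_n].

Definition order_iso (u v : seq nat) : bool :=
  (size u == size v) &&
  [forall i : 'I_(size u), forall j : 'I_(size u),
     (nth 0 u i < nth 0 u j) == (nth 0 v i < nth 0 v j)].

(* Bit masks of length size w select exactly the subsequences of w. *)
Definition word_contains (w tau : seq nat) : bool :=
  [exists m : (size w).-tuple bool, order_iso (mask m w) tau].

Lemma word_containsP (w tau : seq nat) :
  reflect (exists2 t, subseq t w & order_iso t tau) (word_contains w tau).
Proof.
apply: (iffP existsP) => [[m iso]|[t /subseqP[m sz_m ->] iso]].
  by exists (mask m w); rewrite ?mask_subseq.
by exists (@Tuple _ _ m (introT eqP sz_m)).
Qed.

Definition avoids (n : nat) (s : 'S_n) (tau : seq nat) : bool :=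
  ~~ word_contains (one_line s) tau.

Definition is_cycle_max (n : nat) (s : 'S_n) (x : 'I_n) : bool :=
  [forall y : 'I_n, (y \in porbit s x) ==> (y <= x)].

(* The cycle with largest element x is written x, s x, s (s x), and so on;
   enum 'I_n is increasing, hence so are the leading elements of the cycles. *)
Definition standard_cycles (n : nat) (s : 'S_n) : seq (seq 'I_n) :=
  [seq traject s x #|porbit s x| | x <- enum 'I_n & is_cycle_max s x].

Definition theta_word (n : nat) (s : 'S_n) : seq 'I_n :=
  flatten (standard_cycles s).

Lemma is_cycle_max_inj (n : nat) (s : 'S_n) (x y : 'I_n) :
  is_cycle_max s x -> is_cycle_max s y -> porbit s x = porbit s y -> x = y.
Proof.
move=> /forallP mx /forallP my eq_xy.
move: (mx y) (my x); rewrite eq_xy porbit_id -eq_xy porbit_id /= => le_yx le_xy.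
by apply/val_inj/eqP; rewrite eqn_leq le_xy le_yx.
Qed.

Lemma theta_word_uniq (n : nat) (s : 'S_n) : uniq (theta_word s).
Proof.
rewrite /theta_word /standard_cycles.
have: all (is_cycle_max s) [seq x <- enum 'I_n | is_cycle_max s x].
  exact: filter_all.
have: uniq [seq x <- enum 'I_n | is_cycle_max s x].
  by rewrite filter_uniq ?enum_uniq.
elim: [seq x <- _ | _] => //= x r IHr /andP[x_r uniq_r] /andP[mx mr].
rewrite cat_uniq uniq_traject_porbit IHr // andbT /=.
apply/hasPn => z /flatten_mapP[y r_y].
rewrite -porbit_traject => z_y; apply: contra x_r => z_x.
suff -> : x = y by [].
apply: (is_cycle_max_inj mx (allP mr _ r_y)).
rewrite -porbit_traject -eq_porbit_mem in z_x.
rewrite -eq_porbit_mem in z_y.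
by rewrite -(eqP z_x) (eqP z_y).
Qed.

Lemma mem_theta_word (n : nat) (s : 'S_n) (z : 'I_n) : z \in theta_word s.
Proof.
case: (@arg_maxnP _ z (mem (porbit s z)) val (porbit_id s z)) => x z_x max_x.
have eq_xz : porbit s x = porbit s z by apply/eqP; rewrite eq_porbit_mem.
apply/flatten_mapP; exists x; last by rewrite -porbit_traject eq_xz porbit_id.
rewrite mem_filter mem_enum andbT; apply/forallP => y.
by apply/implyP; rewrite eq_xz => /max_x.
Qed.

Lemma size_theta_word (n : nat) (s : 'S_n) : size (theta_word s) == n.
Proof.
rewrite -(card_uniqP (theta_word_uniq s)) -[X in _ == X]card_ord.
by apply/eqP/eq_card => z; rewrite mem_theta_word.
Qed.

Lemma theta_inj (n : nat) (s : 'S_n) :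
  injective (tnth (Tuple (size_theta_word s))).
Proof. exact/tuple_uniqP/theta_word_uniq. Qed.

Definition theta (n : nat) (s : 'S_n) : 'S_n := perm (@theta_inj n s).

Lemma one_line_theta (n : nat) (s : 'S_n) :
  one_line (theta s) = [seq (val x).+1 | x <- theta_word s].
Proof.
rewrite /one_line (eq_map (fun i => congr1 (fun x : 'I_n => (val x).+1)
  (permE (@theta_inj n s) i))).
by rewrite (map_comp (fun x : 'I_n => (val x).+1)) map_tnth_enum.
Qed.

(* Main.v *)
Require Import Defs.
From mathcomp Require Import all_boot all_fingroup zify.

Set Implicit Arguments.
Unset Strict Implicit.
Unset Printing Implicit Defensive.

(** Both [s] and [theta s] avoid 231 if and only if [i <= s i + 1] for all [i].

    If [theta s] avoids 231, then everything written before the maximum of a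
    cycle is smaller than the rest of that cycle, so the cycles of [s] are
    intervals.  If [s] also avoids 231, each cycle word ends with its minimum,
    hence, avoiding 231, is decreasing: every cycle is [(m, m-1, ..., l)].
    Conversely [i <= s i + 1] forces the cycles to have this shape.

    Such permutations of [n + 1] points are obtained in exactly two ways from
    those of [n] points: append a fixed maximum, then possibly exchange the two
    largest values. *)

(** * Occurrences of 231 in words *)

Lemma order_iso_231P (u : seq nat) :
  reflect (exists x y z, u = [:: x; y; z] /\ z < x < y)
          (order_iso u [:: 2; 3; 1]).
Proof.
apply: (iffP andP) => [[/eqP sz_u /forallP iso]|[x [y [z [-> lt_zxy]]]]].
  case: u sz_u iso => [|x [|y [|z []]]] //= _ iso; exists x, y, z; split=> //.
  move/forallP: (iso ord0) => iso0; move/forallP: (iso ord_max) => iso2.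
  by have /eqP := iso2 ord0; have /eqP := iso0 (lift ord0 ord0) => /= -> ->.
split=> //; apply/forallP=> [[i lt_i]]; apply/forallP=> [[j lt_j]] /=.
by case: i lt_i => [|[|[|i]]] // _; case: j lt_j => [|[|[|j]]] //= _; lia.
Qed.

(** The map [f] lets one criterion serve both words: [a], [b], [c] are positions for [one_line s],
    and values for [theta s]. *)
Lemma map_contains_231P (T : eqType) (f : T -> nat) (w : seq T) :
  reflect (exists a b c, subseq [:: a; b; c] w /\ f c < f a < f b)
          (word_contains (map f w) [:: 2; 3; 1]).
Proof.
apply: (iffP (word_containsP _ _)) => [[t]|[a [b [c [sub_w lt_f]]]]].
  move/subseqP=> [m sz_m ->] /order_iso_231P[x [y [z []]]].
  rewrite -map_mask => def_xyz lt_zxy.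
  case def_u: (mask m w) def_xyz => [|a [|b [|c []]]] //= [eq_x eq_y eq_z].
  exists a, b, c; rewrite -def_u mask_subseq eq_x eq_y eq_z.
  by split.
exists (map f [:: a; b; c]); first exact: map_subseq.
by apply/order_iso_231P; exists (f a), (f b), (f c).
Qed.

Lemma subseq_nth3 (T : eqType) (x0 : T) (w : seq T) i j k :
  i < j -> j < k -> k < size w ->
  subseq [:: nth x0 w i; nth x0 w j; nth x0 w k] w.
Proof.
have sub1 v m : m < size v -> subseq [:: nth x0 v m] v.
  by move=> lt_m; rewrite sub1seq mem_nth.
have sub2 v m p : m < p -> p < size v -> subseq [:: nth x0 v m; nth x0 v p] v.
  elim: v m p => [|y v IHv] [|m] [|p] //= lt_mp lt_p.
    by rewrite eqxx; apply: sub1.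
  by apply: subseq_trans (IHv _ _ _ _) (subseq_cons v y).
elim: w i j k => [|y w IHw] [|i] [|j] [|k] //= lt_ij lt_jk lt_k.
  by rewrite eqxx; apply: sub2.
by apply: subseq_trans (IHw _ _ _ _ _ _) (subseq_cons w y).
Qed.

(** * Avoidance of 231 by [s] and by [theta s] *)

Section OrdinalWords.

Variable n : nat.

Lemma pairwise_enum_ord : pairwise (fun a b : 'I_n => a < b) (enum 'I_n).
Proof.
have := iota_ltn_sorted 0 n.
by rewrite -val_enum_ord (sorted_pairwise ltn_trans) pairwise_map.
Qed.

Lemma subseq_enum_ord (u : seq 'I_n) :
  sorted (fun a b : 'I_n => a < b) u -> subseq u (enum 'I_n).
Proof.
pose lt_ord (a b : 'I_n) := a < b.
have lt_trans : transitive lt_ord by move=> b a c; apply: ltn_trans.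
have lt_irr : irreflexive lt_ord by move=> a; apply: ltnn.
move=> sorted_u; suff -> : u = [seq x <- enum 'I_n | x \in u].
  exact: filter_subseq.
apply: (irr_sorted_eq lt_trans lt_irr) => //.
  rewrite sorted_pairwise //; apply: subseq_pairwise (filter_subseq _ _) _.
  exact: pairwise_enum_ord.
by move=> x; rewrite mem_filter mem_enum andbT.
Qed.

Lemma avoids_231P (s : 'S_n) :
  reflect (forall a b c : 'I_n, a < b -> b < c -> ~ (s c < s a < s b))
          (avoids s [:: 2; 3; 1]).
Proof.
apply: (iffP negP) => [av a b c lt_ab lt_bc lt_s|av].
  apply/av/map_contains_231P; exists a, b, c; split=> //.
  by apply: subseq_enum_ord; rewrite /= lt_ab lt_bc.
move/map_contains_231P=> [a [b [c [sub_abc lt_s]]]].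
have := subseq_pairwise sub_abc pairwise_enum_ord.
rewrite /= !andbT => /andP[/andP[lt_ab _] lt_bc].
exact: av lt_ab lt_bc lt_s.
Qed.

Lemma avoids_theta_231P (s : 'S_n) :
  reflect (forall a b c : 'I_n, subseq [:: a; b; c] (theta_word s) ->
             ~ (c < a < b))
          (avoids (theta s) [:: 2; 3; 1]).
Proof.
rewrite /avoids one_line_theta.
apply: (iffP negP) => [av a b c sub_abc lt_abc|av].
  by apply/av/map_contains_231P; exists a, b, c.
by move/map_contains_231P=> [a [b [c [/av nlt lt_abc]]]]; apply: nlt.
Qed.

End OrdinalWords.

(** * Cycles, their maxima, and their place in the word of [theta s] *)

Section Cycles.

Variables (n : nat) (s : 'S_n).

Lemma porbit_iter (x : 'I_n) k : iter k s x \in porbit s x.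
Proof. by rewrite -permX mem_porbit. Qed.

Lemma porbit_iterP (x y : 'I_n) :
  reflect (exists2 k, k < #|porbit s x| & y = iter k s x) (y \in porbit s x).
Proof. rewrite porbit_traject; exact: trajectP. Qed.

Lemma iter_porbit_inj (x : 'I_n) k l :
  k < #|porbit s x| -> l < #|porbit s x| -> iter k s x = iter l s x -> k = l.
Proof.
move=> lt_k lt_l; rewrite -(nth_traject s lt_k) -(nth_traject s lt_l).
move/eqP; rewrite nth_uniq ?size_traject ?uniq_traject_porbit //.
by move/eqP.
Qed.

Lemma porbit_gt0 (x : 'I_n) : 0 < #|porbit s x|.
Proof. by apply/card_gt0P; exists x; apply: porbit_id. Qed.

Lemma cycle_max_ge (x y : 'I_n) : is_cycle_max s x -> y \in porbit s x -> y <= x.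
Proof. by move=> /forallP /(_ y) /implyP. Qed.

Lemma exists_cycle_max (z : 'I_n) :
  exists2 x, is_cycle_max s x & z \in porbit s x.
Proof.
case: (@arg_maxnP _ z (mem (porbit s z)) val (porbit_id s z)) => x z_x max_x.
have eq_xz : porbit s x = porbit s z by apply/eqP; rewrite eq_porbit_mem.
exists x; last by rewrite eq_xz porbit_id.
by apply/forallP => y; apply/implyP; rewrite eq_xz => /max_x.
Qed.

Lemma cycle_max_mem_inj (x y : 'I_n) :
  is_cycle_max s x -> is_cycle_max s y -> x \in porbit s y -> x = y.
Proof.
by move=> mx my; rewrite -eq_porbit_mem => /eqP /(is_cycle_max_inj mx my).
Qed.

Lemma subseq_traject_theta_word (x : 'I_n) :
  is_cycle_max s x -> subseq (traject s x #|porbit s x|) (theta_word s).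
Proof.
move=> mx; rewrite /theta_word /standard_cycles.
have : x \in [seq x <- enum 'I_n | is_cycle_max s x].
  by rewrite mem_filter mx mem_enum.
case/splitPr=> r1 r2; rewrite map_cat flatten_cat /=.
by apply: subseq_trans (suffix_subseq _ _); apply: prefix_subseq.
Qed.

Lemma subseq_traject2_theta_word (x y : 'I_n) :
  is_cycle_max s x -> is_cycle_max s y -> x < y ->
  subseq (traject s x #|porbit s x| ++ traject s y #|porbit s y|)
         (theta_word s).
Proof.
move=> mx my lt_xy; rewrite /theta_word /standard_cycles.
have : subseq [:: x; y] [seq x <- enum 'I_n | is_cycle_max s x].
  by rewrite subseq_filter /= mx my subseq_enum_ord //= lt_xy.
elim: [seq x <- _ | _] => //= z r IHr; case: eqP => [<-|_] sub_r; last first.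
  exact: subseq_trans (IHr sub_r) (suffix_subseq _ _).
apply: cat_subseq => //; move: sub_r; rewrite sub1seq => /splitPr[r1 r2].
rewrite map_cat flatten_cat /=.
by apply: subseq_trans (suffix_subseq _ _); apply: prefix_subseq.
Qed.

End Cycles.

Definition small_drops (n : nat) (s : 'S_n) : bool :=
  [forall i : 'I_n, i <= (s i).+1].

(** * From avoidance to small drops *)

Section AvoidersHaveSmallDrops.

Variables (n : nat) (s : 'S_n).
Hypothesis avoid_s : avoids s [:: 2; 3; 1].

(* If [c] is sent to the maximum of its cycle, avoidance makes [s] stabilise
   the part of the cycle lying below [c], so this part is empty. *)
Lemma cycle_last_min (x y : 'I_n) :
  is_cycle_max s x -> y \in porbit s x -> (s^-1)%g x <= y.
Proof.
move=> mx y_x; set c := (s^-1)%g x; rewrite leqNgt; apply/negP => lt_yc.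
have sc : s c = x by rewrite permKV.
have orb_s z : z \in porbit s x -> s z \in porbit s x.
  by case/porbit_iterP=> k _ ->; rewrite -iterS porbit_iter.
have below_stable a : a \in porbit s x -> a < c -> s a < c.
  move=> a_x lt_ac; rewrite ltnNge; apply/negP => le_csa.
  (* Otherwise [s] would map [U] into itself, hence onto itself by finiteness, although [s a] in [U]
     comes from [a] outside [U]. *)
  pose U := [set b in porbit s x | c <= b].
  have sU : s @: U \subset U.
    apply/subsetP=> _ /imsetP[b + ->]; rewrite !inE => /andP[b_x le_cb].
    rewrite orb_s //=; case: (ltngtP c b) le_cb => // [lt_cb|eq_cb] _.
      (* At positions [a < c < b] the middle value [s c = x] is the largest of the three, so
         avoidance forces [s a <= s b]. *)
      have /negP := (avoids_231P s avoid_s) _ _ _ lt_ac lt_cb.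
      have neq : s a != s c.
        by rewrite (inj_eq perm_inj) -val_eqE /= neq_ltn lt_ac.
      have := cycle_max_ge mx (orb_s _ a_x); rewrite -sc => le_sac.
      have lt_sac : s a < s c by rewrite ltn_neqAle le_sac andbT; apply: neq.
      by rewrite lt_sac andbT -leqNgt; apply: leq_trans.
    have <- : c = b by apply: val_inj.
    by rewrite (leq_trans le_csa) // sc; apply: cycle_max_ge (orb_s _ a_x).
  have eqU : s @: U = U.
    by apply/eqP; rewrite eqEcard sU card_imset ?leqnn //; apply: perm_inj.
  have : s a \in U by rewrite inE orb_s.
  rewrite -eqU mem_imset ?inE; last exact: perm_inj.
  by rewrite a_x leqNgt lt_ac.
have below k : (iter k s y \in porbit s x) && (iter k s y < c).
  elim: k => [|k /andP[orb lt_c]] /=; first by rewrite y_x.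
  by rewrite orb_s // below_stable.
have : c \in porbit s y.
  rewrite (eqP (_ : porbit s y == porbit s x)) ?eq_porbit_mem //.
  by rewrite -porbitV; exact: (mem_porbit s^-1%g 1 x).
by case/porbit_iterP=> k _ def_c; have := below k; rewrite -def_c ltnn andbF.
Qed.

Hypothesis avoid_theta : avoids (theta s) [:: 2; 3; 1].

(** The cycle word ends with its minimum, the preimage of [x]. An ascent before this last entry
    would form a 231 with it in [theta s]. *)
Lemma traject_decreasing (x : 'I_n) k l :
  is_cycle_max s x -> k < l -> l < #|porbit s x| ->
  iter l s x < iter k s x.
Proof.
move=> mx lt_kl lt_l; set N := #|porbit s x| in lt_l *.
have lt_kN : k < N by apply: ltn_trans lt_l.
have last_x : (s^-1)%g x = iter N.-1 s x.
  apply: (@perm_inj _ s); rewrite permKV -iterS prednK ?iter_porbit //.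
  exact: porbit_gt0.
have lt_last m : m < N.-1 -> iter N.-1 s x < iter m s x.
  move=> lt_m; rewrite ltn_neqAle -last_x (cycle_last_min mx) ?porbit_iter //.
  rewrite andbT last_x; apply/eqP => /val_inj /iter_porbit_inj.
  by rewrite -/N; lia.
have [le_Nl|lt_lN] := leqP N.-1 l.
  by have -> : l = N.-1 by [lia]; apply: lt_last; lia.
rewrite ltnNge leq_eqVlt; apply/negP => /orP[/eqP /val_inj|lt_x].
  by move/iter_porbit_inj; rewrite -/N; lia.
have := subseq_nth3 x lt_kl lt_lN (_ : N.-1 < size (traject s x N)).
rewrite size_traject !nth_traject ?prednK ?porbit_gt0 //; try lia.
move=> /(_ (leqnn _)) /subseq_trans /(_ (subseq_traject_theta_word mx)).
by move/(avoids_theta_231P s avoid_theta); rewrite lt_last ?lt_x //; lia.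
Qed.

(** The maximum [y] opens its cycle word, after the whole cycle of [x]. If [b < a], then [a], [y],
    [b] would be a 231 in [theta s]. *)
Lemma cycles_ordered (x y a b : 'I_n) :
  is_cycle_max s x -> is_cycle_max s y -> x < y ->
  a \in porbit s x -> b \in porbit s y -> a < b.
Proof.
move=> mx my lt_xy a_x b_y.
have lt_ay : a < y by apply: leq_ltn_trans lt_xy; apply: cycle_max_ge a_x.
have [-> //|neq_by] := eqVneq b y.
rewrite ltnNge leq_eqVlt; apply/negP => /orP[/eqP /val_inj eq_ba|lt_ba].
  have x_y : x \in porbit s y 
    by rewrite -eq_ba -!eq_porbit_mem in a_x b_y *; rewrite -(eqP a_x).
  by move: lt_xy; rewrite (cycle_max_mem_inj mx my x_y) ltnn.
have sub_ayb : subseq [:: a; y; b] (theta_word s).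
  apply: subseq_trans (subseq_traject2_theta_word mx my lt_xy).
  rewrite -[[:: a; y; b]]/([:: a] ++ [:: y; b]); apply: cat_subseq.
    by rewrite sub1seq -porbit_traject.
  move: b_y; rewrite porbit_traject.
  case: #|_| => //= m; rewrite eqxx inE (negPf neq_by) /= => b_m.
  by rewrite sub1seq.
by apply: (avoids_theta_231P s avoid_theta) sub_ayb _; rewrite lt_ba.
Qed.

(** If [s i + 1 < i], the value [t = s i + 1] lies strictly between [s i] and [i]. Since cycles are
    ordered, [t] belongs to their cycle, but a decreasing cycle word has no room for it between the
    consecutive entries [i] and [s i]. *)
Lemma avoids_small_drops : small_drops s.
Proof.
apply/forallP=> i; rewrite leqNgt; apply/negP => lt_i.
have lt_t : (s i).+1 < n by apply: ltn_trans (ltn_ord i).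
pose t := Ordinal lt_t.
have [x mx i_x] := exists_cycle_max s i; have [y my t_y] := exists_cycle_max s t.
have [k lt_k def_i] := porbit_iterP _ _ _ i_x.
have def_si : s i = iter k.+1 s x by rewrite def_i.
have si_x : s i \in porbit s x by rewrite def_si porbit_iter.
case: (ltngtP x y) => [lt_xy|lt_yx|/val_inj eq_xy].
- by have := cycles_ordered mx my lt_xy i_x t_y; rewrite /=; lia.
- by have := cycles_ordered my mx lt_yx t_y si_x; rewrite /=; lia.
rewrite -{}eq_xy in t_y; have [l lt_l def_t] := porbit_iterP _ _ _ t_y.
have val_t : iter l s x = (s i).+1 :> nat by rewrite -def_t.
have lt_k1 : k.+1 < #|porbit s x|.
  rewrite ltn_neqAle lt_k andbT; apply/eqP => eq_k.
  have := cycle_max_ge mx i_x; move: lt_i; rewrite def_si eq_k iter_porbit; lia.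
case: (ltngtP l k) => [lt_lk|lt_kl|eq_lk].
- by have := traject_decreasing mx lt_lk lt_k; rewrite -def_i val_t; lia.
- case: (ltngtP l k.+1) => [|lt_k1l|eq_l]; first lia.
    by have := traject_decreasing mx lt_k1l lt_l; rewrite -def_si val_t; lia.
  by move: val_t; rewrite eq_l -def_si; lia.
by move: val_t; rewrite eq_lk -def_i; lia.
Qed.

End AvoidersHaveSmallDrops.

(** * From small drops to avoidance *)

Section SmallDropsAvoid.

Variables (n : nat) (s : 'S_n).
Hypothesis drops_s : small_drops s.

(* The [c] values below [c] occupy positions among the [c.+1] first ones, so
   only one position up to [c] may carry a value at least [c]. *)
Lemma small_drops_avoids : avoids s [:: 2; 3; 1].
Proof.
apply/avoids_231P=> a b c lt_ab lt_bc /andP[lt_ca lt_sab].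
have drop (i : 'I_n) : i <= (s i).+1 by move/forallP: drops_s.
have dc := drop c.
pose V := [set i : 'I_n | i < c].
have cardV : #|V| = c.
  rewrite -sum1_card (eq_bigl (fun i : 'I_n => i < c)).
    by rewrite (big_ord_narrow (ltnW (ltn_ord c))) sum1_card card_ord.
  by move=> i; rewrite inE.
(* Since [c <= s c + 1] and [s c < s a < s b], both [s a] and [s b] are at least [c]. The preimage
   of [V], of size [c], must then fit into a set of size [c - 1]. *)
have sub : (s @^-1: V) \subset (c |: V) :\ a :\ b.
  apply/subsetP=> i; rewrite !inE => lt_ic; have di := drop i.
  apply/and3P; split.
  - by apply/eqP=> eq_i; move: lt_ic; rewrite eq_i; lia.
  - by apply/eqP=> eq_i; move: lt_ic; rewrite eq_i; lia.
  - by rewrite -val_eqE /=; lia.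
have := subset_leq_card sub; rewrite card_preimset; last exact: perm_inj.
have : #|c |: V| = c.+1 by rewrite cardsU1 inE ltnn cardV.
rewrite (cardsD1 a) (cardsD1 b (_ :\ a)) cardV.
have -> : a \in c |: V by rewrite !inE (ltn_trans lt_ab lt_bc) orbT.
have -> : b \in (c |: V) :\ a.
  by rewrite !inE lt_bc orbT andbT -val_eqE /= neq_ltn lt_ab orbT.
by move=> /succn_inj eq_c; rewrite -{1}eq_c ltnn.
Qed.

(** Each step goes down by at most one, and it cannot go up or stay: by induction every value from
    the current entry up to [x] has already been visited. *)
Lemma traject_consecutive (x : 'I_n) k :
  is_cycle_max s x -> k < #|porbit s x| -> iter k s x + k = x :> nat.
Proof.
move=> mx; elim/ltn_ind: k => [[|k]] IHk lt_k //=; first by rewrite addn0.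
have IH := IHk k (ltnSn k) (ltnW lt_k).
have drop : iter k s x <= (s (iter k s x)).+1 by move/forallP: drops_s.
have le_x : iter k.+1 s x <= x by apply: (cycle_max_ge mx); apply: porbit_iter.
move: le_x; rewrite /=; set v := s (iter k s x) in drop * => le_x.
have [ge_v|lt_v] := leqP (iter k s x) v; last lia.
(* The index at which the value [v] already occurred. *)
pose j := x - v.
have lt_j : j < #|porbit s x| by rewrite /j; lia.
have eq_j := IHk j _ lt_j.
have /val_inj : iter j s x = v :> nat by have := eq_j; rewrite /j; lia.
by rewrite /v -iterS => /(iter_porbit_inj lt_j lt_k); rewrite /j; lia.
Qed.

Lemma small_drops_porbit_convex (x z t : 'I_n) :
  is_cycle_max s x -> z \in porbit s x -> z <= t -> t <= x ->
  t \in porbit s x.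
Proof.
move=> mx /porbit_iterP[k lt_k def_z] le_zt le_tx.
have eq_k := traject_consecutive mx lt_k; rewrite -def_z in eq_k.
have lt_j : x - t < #|porbit s x| by lia.
have eq_j := traject_consecutive mx lt_j.
by have -> : t = iter (x - t) s x; [apply: ord_inj; lia | apply: porbit_iter].
Qed.

(** The word consists of decreasing blocks, one per cycle, whose values increase from block to
    block. The pairwise form passes to subsequences. *)
Lemma small_drops_theta_word :
  pairwise (fun a b => if b \in porbit s a then b < a else a < b)
           (theta_word s).
Proof.
rewrite /theta_word /standard_cycles.
have : all (is_cycle_max s) [seq x <- enum 'I_n | is_cycle_max s x].
  exact: filter_all.
have : pairwise (fun a b : 'I_n => a < b)
         [seq x <- enum 'I_n | is_cycle_max s x].
  exact: subseq_pairwise (filter_subseq _ _) (pairwise_enum_ord n).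
elim: [seq x <- _ | _] => //= x r IHr /andP[/allP lt_r pw_r] /andP[mx mr].
rewrite pairwise_cat IHr // andbT; apply/andP; split.
  apply/allrelP=> a b; rewrite -porbit_traject => a_x /flatten_mapP[y r_y].
  rewrite -porbit_traject => b_y; have lt_xy := lt_r y r_y.
  have my := allP mr y r_y.
  have nx_y : x \notin porbit s y.
    apply/negP=> x_y; move: lt_xy.
    by rewrite (cycle_max_mem_inj mx my x_y) ltnn.
  have /negPf -> : b \notin porbit s a.
    apply: contra nx_y; rewrite -!eq_porbit_mem in a_x b_y *.
    by rewrite (eqP b_y) (eqP a_x) eq_sym.
  (* From [b <= a <= x < y], convexity would put [x] in the cycle of [y]. *)
  rewrite ltnNge; apply/negP => le_ba; case/negP: nx_y.
  apply: small_drops_porbit_convex my b_y _ (ltnW lt_xy).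
  exact: leq_trans le_ba (cycle_max_ge mx a_x).
apply/(pairwiseP x)=> k l; rewrite !inE size_traject => lt_k lt_l lt_kl.
rewrite !nth_traject //.
have eq_k := traject_consecutive mx lt_k.
have eq_l := traject_consecutive mx lt_l.
have -> : iter l s x \in porbit s (iter k s x).
  by rewrite -eq_porbit_mem -!permX !porbit_perm.
by rewrite -(ltn_add2r l) eq_l -{1}eq_k ltn_add2l.
Qed.

(** In a 231 the descents from [a] to [c] and from [b] to [c] lie within one cycle, whereas the
    ascent from [a] to [b] joins distinct cycles. *)
Lemma small_drops_avoids_theta : avoids (theta s) [:: 2; 3; 1].
Proof.
apply/avoids_theta_231P=> a b c sub_abc /andP[lt_ca lt_ab].
have := subseq_pairwise sub_abc small_drops_theta_word.
rewrite /= !andbT => /andP[/andP[]].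
case: ifP => [|nb_a]; first lia.
case: ifP => [c_a|]; last lia.
case: ifP => [c_b|]; last lia.
move: nb_a; rewrite -!eq_porbit_mem in c_a c_b *.
by rewrite -(eqP c_b) (eqP c_a) eqxx.
Qed.

End SmallDropsAvoid.

Lemma avoids_and_theta_avoids (n : nat) (s : 'S_n) :
  avoids s [:: 2; 3; 1] && avoids (theta s) [:: 2; 3; 1] = small_drops s.
Proof.
apply/andP/idP => [[]|drops]; first exact: avoids_small_drops.
by split; [apply: small_drops_avoids | apply: small_drops_avoids_theta].
Qed.

(** * Counting permutations with small drops *)

Section Counting.

Variable n : nat.

Definition penult : 'I_n.+2 := widen_ord (leqnSn _) ord_max.

Lemma penult_neq_max : penult != ord_max.
Proof. by rewrite -val_eqE /= neq_ltn ltnSn. Qed.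

(** Products apply the left factor first, so the transposition acts on values, not positions. *)
Definition extend_perm (bs : bool * 'S_n.+1) : 'S_n.+2 :=
  (lift_perm ord_max ord_max bs.2 *
   (if bs.1 then tperm penult ord_max else 1))%g.

Lemma extend_perm_max bs :
  extend_perm bs ord_max = if bs.1 then penult else ord_max.
Proof. by rewrite permM lift_perm_id; case: ifP; rewrite ?tpermR ?perm1. Qed.

Lemma extend_perm_lift bs (i : 'I_n.+1) :
  extend_perm bs (lift ord_max i) =
  (if bs.1 && (bs.2 i == ord_max) then n.+1 else bs.2 i) :> nat.
Proof.
rewrite permM lift_perm_lift; case: bs.1 => /=; last by rewrite perm1 lift_max.
have neq_max : ord_max != lift ord_max (bs.2 i) by apply: neq_lift.
have [eq_max|neq_i] := eqVneq (bs.2 i) ord_max.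
  have -> : lift ord_max (bs.2 i) = penult.
    by apply: ord_inj; rewrite lift_max eq_max.
  by rewrite tpermL.
rewrite tpermD // ?lift_max //; apply: contraNneq neq_i => eq_i.
by apply/eqP/ord_inj; rewrite -(lift_max (bs.2 i)) -eq_i.
Qed.

Lemma extend_perm_inj : injective extend_perm.
Proof.
move=> [b s] [c t] eq_e.
have eq_bc : b = c.
  have := congr1 (fun u : 'S_n.+2 => u ord_max) eq_e.
  have := penult_neq_max; rewrite !extend_perm_max /=.
  by case: b c {eq_e} => [] [] // /eqP neq eq_p; case: neq.
rewrite -{}eq_bc /extend_perm /= in eq_e *; move/mulIg: eq_e => eq_l.
congr (b, _); apply/permP=> i; apply: (@lift_inj _ ord_max).
by rewrite -!(lift_perm_lift ord_max) eq_l.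
Qed.

(** The exchange affects only the values [n] and [n.+1], and a value at least [n] satisfies the
    bound at every position. *)
Lemma small_drops_extend b s :
  small_drops (extend_perm (b, s)) = small_drops s.
Proof.
apply/forallP/forallP => drops i.
  have := drops (lift ord_max i); rewrite extend_perm_lift lift_max /=.
  by case: ifP => // /andP[_ /eqP ->] _; apply: ltnW; apply: ltn_ord.
case: (unliftP ord_max i) => [j ->|->].
  rewrite extend_perm_lift lift_max /=; case: ifP => _; last exact: drops.
  by rewrite (leq_trans (ltnW (ltn_ord j))).
by rewrite extend_perm_max; case: ifP.
Qed.

Lemma lift_perm_fix_max (u : 'S_n.+2) :
  u ord_max = ord_max -> exists s, u = lift_perm ord_max ord_max s.
Proof.
move=> u_max.
(* The default [i] never occurs: [u] fixes [ord_max], so it sends no other position there. *)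
pose f (i : 'I_n.+1) := odflt i (unlift ord_max (u (lift ord_max i))).
have lift_f i : lift ord_max (f i) = u (lift ord_max i).
  rewrite /f; case: unliftP => //= eq_u.
  have := neq_lift ord_max i; rewrite -(inj_eq (@perm_inj _ u)) u_max.
  by rewrite eq_u eqxx.
have inj_f : injective f.
  by move=> i j eq_f; apply: (@lift_inj _ ord_max); apply: (@perm_inj _ u);
     rewrite -!lift_f eq_f.
exists (perm inj_f); apply/permP=> i; case: (unliftP ord_max i) => [j ->|->].
  by rewrite lift_perm_lift permE lift_f.
by rewrite lift_perm_id.
Qed.

Lemma small_drops_image :
  [set s : 'S_n.+2 | small_drops s] =
  extend_perm @: setX setT [set s : 'S_n.+1 | small_drops s].
Proof.
apply/setP=> u; rewrite inE; apply/idP/imsetP => [drops|]; last first.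
  by move=> [[b s]]; rewrite !inE /= => drops ->; rewrite small_drops_extend.
have [b [s def_u]] : exists b s, u = extend_perm (b, s).
  have [u_max|u_nmax] := eqVneq (u ord_max) ord_max.
    have [s ->] := lift_perm_fix_max u_max.
    by exists false, s; rewrite /extend_perm mulg1.
  (* The bound at the last position gives [n <= u ord_max], which leaves only the two largest
     values. *)
  have u_pen : u ord_max = penult.
    apply: val_inj; move/forallP/(_ ord_max): drops.
    move: u_nmax (ltn_ord (u ord_max)); rewrite -val_eqE /=; lia.
  have [|s def_s] := @lift_perm_fix_max (u * tperm penult ord_max)%g.
    by rewrite permM u_pen tpermL.
  by exists true, s; rewrite /extend_perm -def_s /= -mulgA tperm2 mulg1.
exists (b, s) => //; rewrite !inE /=.
by rewrite -(small_drops_extend b) -def_u.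
Qed.

End Counting.

Lemma card_small_drops (n : nat) : #|[set s : 'S_n.+1 | small_drops s]| = 2 ^ n.
Proof.
elim: n => [|n IHn].
  have -> : [set s : 'S_1 | small_drops s] = [set: 'S_1].
    by apply/setP=> s; rewrite !inE; apply/forallP=> i; rewrite [i]ord1.
  by rewrite cardsT card_Sn.
rewrite small_drops_image card_imset; last exact: extend_perm_inj.
by rewrite cardsX cardsT card_bool IHn expnS.
Qed.

Theorem theorem3p8 (n : nat) (hn : 1 <= n) :
  #|[set s : 'S_n | avoids s [:: 2; 3; 1] && avoids (theta s) [:: 2; 3; 1]]|
  = 2 ^ (n - 1).
Proof.
case: n hn => // n _; rewrite subn1 -card_small_drops.
by apply: eq_card => s; rewrite !inE avoids_and_theta_avoids.
Qed.
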